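(* Let $R$ be a finite ring, and let $\Phi\colon R\to\mathbb{F}_2^r$ be the composition $$R\to R^{ss}\cong\mathbb{F}_2^r\times R_0\to\mathbb{F}_2^r,$$ where $R_0$ has no quotient isomorphic to $\mathbb{F}_2$. Let $S_1,\dots,S_m$ be the orbits (double cosets) $R^\times xR^\times$ of $R$ under the left and right multiplication actions of $R^\times$. Let $\Gamma(R,S)$ be a gcd-graph over $R$, where $S=\bigsqcup_{i\in I}S_i$ for some $I\subset\{1,2,\dots,m\}$. For each $i\in I$, let $I_i$ be the two-sided ideal generated by $x_i\in S_i$ ($I_i$ is independent of the choice of $x_i$). Then $\Gamma(R,S)$ is connected if and only if the following conditions hold: (1) $\sum_{i\in I}I_i=R$. (2) The cube-like graph $\Gamma(\mathbb{F}_2^r,\Phi(S))$ is connected.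
   Context: Rings are finite, unital, with $0\neq 1$, not necessarily commutative. $R^{ss}=R/\mathrm{Rad}(R)$, with $\mathrm{Rad}(R)$ the Jacobson radical, is by Artin–Wedderburn a product of matrix rings $M_{n_i}(F_i)$ over finite fields; $r$ is the number of factors equal to $\mathbb{F}_2$ (i.e. $n_i=1$, $F_i=\mathbb{F}_2$) and $R_0$ is the product of the remaining factors. The Cayley graph $\Gamma(R,S)$ has vertex set $R$, and $a,b$ are adjacent if $a-b\in S$; similarly $\Gamma(\mathbb{F}_2^r,\Phi(S))$ is the Cayley graph on the additive group $\mathbb{F}_2^r$ (if $0\in\Phi(S)$ it has a loop at each vertex, which does not affect connectivity). $\Gamma(R,S)$ is called a gcd-graph if $R^\times SR^\times=S$, equivalently if $S$ is a disjoint union of some of the $S_i$. The two-sided ideal generated by $x$ is $\{\sum_i a_ixb_i\mid a_i,b_i\in R\}$. *)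

(* Defs.v *)
From HB Require Import structures.
From mathcomp Require Import all_boot all_algebra.

Set Implicit Arguments.
Unset Strict Implicit.
Unset Printing Implicit Defensive.

Import GRing.Theory.
Local Open Scope ring_scope.

Section Radical.
Variable R : finNzRingType.
Implicit Types (M N : {set R}) (a x y : R).

Definition left_ideal M : bool :=
  [&& 0 \in M, [forall x in M, forall y in M, x - y \in M]
    & [forall a, forall x in M, a * x \in M]].

Definition maximal_left_ideal M : bool :=
  maxset (fun N => left_ideal N && (N != [set: R])) M.

Definition jacobson_radical : {set R} :=
  \bigcap_(M | maximal_left_ideal M) M.

Lemma left_idealP M :
  reflect [/\ 0 \in M, forall x y, x \in M -> y \in M -> x - y \in M
             & forall a x, x \in M -> a * x \in M]
          (left_ideal M).
Proof.
apply: (iffP and3P) => [[M0 /forall_inP MB /forallP MM]|[M0 MB MM]]; split=> //.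
- by move=> x y Mx; apply: (forall_inP (MB x Mx)).
- by move=> a x; apply: (forall_inP (MM a)).
- by apply/forall_inP => x Mx; apply/forall_inP => y; apply: MB.
- by apply/forallP => a; apply/forall_inP => x; apply: MM.
Qed.

Lemma left_ideal_proper M : left_ideal M -> (M != [set: R]) = (1 \notin M).
Proof.
case/left_idealP=> _ _ MM; congr negb; apply/eqP/idP => [->|M1].
  by rewrite in_setT.
by apply/setP => x; rewrite in_setT -[x]mulr1 MM.
Qed.

Lemma left_idealD M x y : left_ideal M -> x \in M -> y \in M -> x + y \in M.
Proof.
case/left_idealP=> M0 MB _ Mx My; rewrite -[y]opprK MB //.
by rewrite -[- y]add0r MB.
Qed.

Lemma maximal_left_idealP M :
  reflect [/\ left_ideal M, 1 \notin M & forall N, left_ideal N ->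
               1 \notin N -> M \subset N -> N = M]
          (maximal_left_ideal M).
Proof.
apply: (iffP maxsetP) => [[/andP[lM pM] mM]|[lM pM mM]].
  by split=> [||N lN N1]; rewrite -?left_ideal_proper //;
     apply: mM; rewrite lN left_ideal_proper.
split=> [|N /andP[lN]]; first by rewrite lM left_ideal_proper.
by rewrite left_ideal_proper //; apply: mM.
Qed.

Lemma maximal_left_ideal_split M z y : maximal_left_ideal M -> z \notin M ->
  exists b, y - b * z \in M.
Proof.
case/maximal_left_idealP=> lM _ mM zM.
have [M0 MB MM] := left_idealP _ lM.
pose N := [set y | [exists b, y - b * z \in M]].
have NP y' : reflect (exists b, y' - b * z \in M) (y' \in N).
  by rewrite inE; apply: existsP.
have lN : left_ideal N.
  apply/left_idealP; split.
  - by apply/NP; exists 0; rewrite mul0r subr0.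
  - move=> u v /NP[b Mb] /NP[c Mc]; apply/NP; exists (b - c).
    suff -> : u - v - (b - c) * z = (u - b * z) - (v - c * z) by apply: MB.
    by rewrite mulrBl !opprB addrACA [RHS]addrACA [- v - _]addrC.
  - move=> a u /NP[b Mb]; apply/NP; exists (a * b).
    by rewrite -mulrA -mulrBr MM.
have sMN : M \subset N.
  by apply/subsetP => u Mu; apply/NP; exists 0; rewrite mul0r subr0.
have zN : z \in N by apply/NP; exists 1; rewrite mul1r subrr.
have [N1|/mM-/(_ lN sMN) eNM] := boolP (1 \in N); last by rewrite -eNM zN in zM.
have [_ _ NM] := left_idealP _ lN.
by apply/NP; rewrite -[y]mulr1 NM.
Qed.

Lemma jacobson_radicalB x y : x \in jacobson_radical ->
  y \in jacobson_radical -> x - y \in jacobson_radical.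
Proof.
move=> /bigcapP Jx /bigcapP Jy; apply/bigcapP => M mM.
have /maximal_left_idealP[/left_idealP[_ MB _] _ _] := mM.
by rewrite MB ?Jx ?Jy.
Qed.

Lemma jacobson_radical0 : 0 \in jacobson_radical.
Proof.
by apply/bigcapP => M /maximal_left_idealP[/left_idealP[M0 _ _] _ _].
Qed.

Lemma jacobson_radicalMl a x :
  x \in jacobson_radical -> a * x \in jacobson_radical.
Proof.
move=> /bigcapP Jx; apply/bigcapP => M mM.
have /maximal_left_idealP[/left_idealP[_ _ MM] _ _] := mM.
by rewrite MM ?Jx.
Qed.

Lemma jacobson_radicalMr a x :
  x \in jacobson_radical -> x * a \in jacobson_radical.
Proof.
move=> /bigcapP Jx; apply/bigcapP => M mM.
have /maximal_left_idealP[lM M1 _] := mM; have [M0 MB MM] := left_idealP _ lM.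
have [Ma|Ma] := boolP (a \in M); first exact: MM.
pose N := [set y | y * a \in M].
have inN y : (y \in N) = (y * a \in M) by rewrite inE.
rewrite -inN; apply: Jx; apply/maximal_left_idealP; split.
- apply/left_idealP; split; first by rewrite inN mul0r.
  + by move=> u v; rewrite !inN mulrBl; apply: MB.
  + by move=> c u; rewrite !inN -mulrA; apply: MM.
- by rewrite inN mul1r.
- move=> K lK K1 sNK; apply/eqP; rewrite eqEsubset sNK andbT.
  apply/subsetP => y Ky; apply: contraNT K1; rewrite inN => Mya.
  have [b] := maximal_left_ideal_split a mM Mya.
  rewrite mulrA -{1}[a]mul1r -mulrBl -inN => /(subsetP sNK) Kb.
  have [_ _ KM] := left_idealP _ lK.
  by rewrite -[1](subrK (b * y)) left_idealD ?KM.
Qed.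

Fact jacobson_radical_zmod_closed :
  zmod_closed (mem jacobson_radical : {pred R}).
Proof.
by split=> [|x y]; [apply: jacobson_radical0 | apply: jacobson_radicalB].
Qed.

Definition in_jacobson_radical : R -> bool := fun x => x \in jacobson_radical.

HB.instance Definition _ :=
  GRing.isZmodClosed.Build R in_jacobson_radical jacobson_radical_zmod_closed.

Definition radical_zmod : zmodClosed R :=
  GRing.ZmodClosed.clone R in_jacobson_radical _.

(* R / Rad R.  Quotient.quot supplies only the additive group when R is not
   commutative; the ring structure is added below. *)
Definition semisimple_quotient : Type :=
  Quotient.quot radical_zmod.

HB.instance Definition _ := GRing.Zmodule.on semisimple_quotient.

Definition ss_proj : R -> semisimple_quotient :=
  \pi_(Quotient.quot radical_zmod)%qT.

Definition ss_one : semisimple_quotient := ss_proj 1.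
Definition ss_mul (x y : semisimple_quotient) : semisimple_quotient :=
  ss_proj (repr (x : Quotient.quot radical_zmod)
           * repr (y : Quotient.quot radical_zmod)).

Lemma ss_projE x y : (ss_proj x == ss_proj y) = (x - y \in jacobson_radical).
Proof. by rewrite -[RHS]/(x - y \in in_jacobson_radical) Quotient.idealrBE. Qed.

Lemma ss_proj_surj (z : semisimple_quotient) : exists x, ss_proj x = z.
Proof. by exists (repr (z : Quotient.quot radical_zmod)); apply: reprK. Qed.

Lemma ss_projB : {morph ss_proj : x y / x - y}.
Proof. by move=> x y; rewrite /ss_proj raddfB. Qed.

Lemma ss_projM : {morph ss_proj : x y / x * y >-> ss_mul x y}.
Proof.
move=> x y; apply/eqP; rewrite ss_projE.
set x' := repr _; set y' := repr _.
have Jx : x - x' \in jacobson_radical by rewrite -ss_projE /ss_proj reprK.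
have Jy : y - y' \in jacobson_radical by rewrite -ss_projE /ss_proj reprK.
rewrite -(subrK (x' * y) (x * y)) -addrA -mulrBl -mulrBr.
rewrite -[x' * _]opprK jacobson_radicalB ?jacobson_radicalMr //.
by rewrite -mulrN jacobson_radicalMl // -sub0r jacobson_radicalB
     ?jacobson_radical0.
Qed.

Fact ss_mulA : associative ss_mul.
Proof.
move=> x y z; have [a <-] := ss_proj_surj x; have [b <-] := ss_proj_surj y.
by have [c <-] := ss_proj_surj z; rewrite -!ss_projM mulrA.
Qed.

Fact ss_mul1 : left_id ss_one ss_mul.
Proof. by move=> x; have [a <-] := ss_proj_surj x; rewrite -ss_projM mul1r. Qed.

Fact ss_mulr1 : right_id ss_one ss_mul.
Proof. by move=> x; have [a <-] := ss_proj_surj x; rewrite -ss_projM mulr1. Qed.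

Fact ss_projD : {morph ss_proj : x y / x + y}.
Proof. by move=> x y; rewrite /ss_proj raddfD. Qed.

Fact ss_mulDl : left_distributive ss_mul +%R.
Proof.
move=> x y z; have [a <-] := ss_proj_surj x; have [b <-] := ss_proj_surj y.
by have [c <-] := ss_proj_surj z; rewrite -ss_projD -!ss_projM mulrDl ss_projD.
Qed.

Fact ss_mulDr : right_distributive ss_mul +%R.
Proof.
move=> x y z; have [a <-] := ss_proj_surj x; have [b <-] := ss_proj_surj y.
by have [c <-] := ss_proj_surj z; rewrite -ss_projD -!ss_projM mulrDr ss_projD.
Qed.

HB.instance Definition _ := GRing.Zmodule_isPzRing.Build semisimple_quotient
  ss_mulA ss_mul1 ss_mulr1 ss_mulDl ss_mulDr.

HB.instance Definition _ :=
  GRing.isZmodMorphism.Build R semisimple_quotient ss_proj ss_projB.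
HB.instance Definition _ :=
  GRing.isMonoidMorphism.Build R semisimple_quotient ss_proj
    (erefl, ss_projM).

Lemma ss_proj_eq0 x : (ss_proj x == 0) = (x \in jacobson_radical).
Proof. by rewrite -(raddf0 ss_proj) ss_projE subr0. Qed.

End Radical.

Section DependentProduct.
Variables (I : finType) (T : I -> pzRingType).

Definition ring_product : Type := {dffun forall i, T i}.

HB.instance Definition _ := Choice.on ring_product.

Implicit Types f g h : ring_product.

Definition rp_zero : ring_product := [ffun i => 0 : T i].
Definition rp_one : ring_product := [ffun i => 1 : T i].
Definition rp_opp f : ring_product := [ffun i => - f i : T i].
Definition rp_add f g : ring_product := [ffun i => f i + g i : T i].
Definition rp_mul f g : ring_product := [ffun i => f i * g i : T i].

Fact rp_addA : associative rp_add.
Proof. by move=> f g h; apply/ffunP => i; rewrite !ffunE addrA. Qed.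
Fact rp_addC : commutative rp_add.
Proof. by move=> f g; apply/ffunP => i; rewrite !ffunE addrC. Qed.
Fact rp_add0 : left_id rp_zero rp_add.
Proof. by move=> f; apply/ffunP => i; rewrite !ffunE add0r. Qed.
Fact rp_addN : left_inverse rp_zero rp_opp rp_add.
Proof. by move=> f; apply/ffunP => i; rewrite !ffunE addNr. Qed.

HB.instance Definition _ :=
  GRing.isZmodule.Build ring_product rp_addA rp_addC rp_add0 rp_addN.

Fact rp_mulA : associative rp_mul.
Proof. by move=> f g h; apply/ffunP => i; rewrite !ffunE mulrA. Qed.
Fact rp_mul1 : left_id rp_one rp_mul.
Proof. by move=> f; apply/ffunP => i; rewrite !ffunE mul1r. Qed.
Fact rp_mulr1 : right_id rp_one rp_mul.
Proof. by move=> f; apply/ffunP => i; rewrite !ffunE mulr1. Qed.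
Fact rp_mulDl : left_distributive rp_mul +%R.
Proof. by move=> f g h; apply/ffunP => i; rewrite !ffunE mulrDl. Qed.
Fact rp_mulDr : right_distributive rp_mul +%R.
Proof. by move=> f g h; apply/ffunP => i; rewrite !ffunE mulrDr. Qed.

HB.instance Definition _ := GRing.Zmodule_isPzRing.Build ring_product
  rp_mulA rp_mul1 rp_mulr1 rp_mulDl rp_mulDr.

End DependentProduct.

(* An alias, so that F_2^r carries both its ring structure (also for r = 0, where
   the ring is trivial) and the structure of a finite additive group. *)
Definition F2_power (r : nat) : Type := {ffun 'I_r -> 'F_2}.

HB.instance Definition _ r := Finite.on (F2_power r).
HB.instance Definition _ r := GRing.PzRing.on (F2_power r).

Definition matrix_product (k : nat) (F : 'I_k -> finFieldType)
    (n : 'I_k -> nat) : pzRingType :=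
  ring_product (fun i => 'M[F i]_(n i) : pzRingType).

Definition has_F2_quotient (A : pzRingType) : Prop :=
  exists f : {rmorphism A -> 'F_2}, forall y, exists x, f x = y.

Section UnitDoubleCosets.
Variable R : finUnitRingType.
Implicit Types (A S : {set R}) (x y : R).

Definition ring_units : {set R} := [set u | u \is a GRing.unit].

(* R^* A R^* *)
Definition unit_mul_set A : {set R} :=
  [set u * w | u in ring_units, w in [set s * v | s in A, v in ring_units]].

Definition unit_double_coset x : {set R} := unit_mul_set [set x].

Definition unit_double_cosets : {set {set R}} :=
  [set unit_double_coset x | x : R].

Definition is_gcd_graph S : Prop := unit_mul_set S = S.

(* y lies in the two-sided ideal generated by x *)
Definition ideal_gen x y : Prop :=
  exists s : seq (R * R), y = \sum_(p <- s) p.1 * x * p.2.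

(* y lies in the sum of the ideals I i, for i in B *)
Definition sum_ideals (J : finType) (B : {set J}) (I : J -> R -> Prop) y : Prop :=
  exists2 z : J -> R, forall i, i \in B -> I i (z i) & y = \sum_(i in B) z i.

Lemma ideal_gen_unit_double_coset x y z : y \in unit_double_coset x ->
  ideal_gen y z <-> ideal_gen x z.
Proof.
case/imset2P=> u w; rewrite inE => Uu /imset2P[_ v /set1P-> + ->] ->.
rewrite inE => Uv; split=> [] [s ->].
  exists [seq (p.1 * u, v * p.2) | p <- s]; rewrite big_map.
  by apply: eq_bigr => p _; rewrite !mulrA.
exists [seq (p.1 * u^-1, v^-1 * p.2) | p <- s]; rewrite big_map.
by apply: eq_bigr => p _; rewrite !mulrA mulrVK // mulrK.
Qed.

End UnitDoubleCosets.

(* The arcs of a Cayley graph are directed in general; the connection sets used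
   here are stable under negation, since -1 is a unit, so that reachability by
   directed paths is connectedness of the undirected graph. *)
Definition cayley_graph (V : finZmodType) (S : {set V}) : rel V :=
  fun a b => a - b \in S.

Definition graph_connected (T : finType) (e : rel T) : Prop :=
  forall a b, connect e a b.

Section Phi.
Variables (R : finUnitRingType) (r : nat) (A : pzRingType).
Variable phi : {rmorphism semisimple_quotient R -> (F2_power r * A)%type}.

Definition F2_projection (x : R) : F2_power r := (phi (ss_proj x)).1.

End Phi.

(* Main.v *)
Require Import Defs.
From HB Require Import structures.
From mathcomp Require Import all_boot all_fingroup all_algebra.

Set Implicit Arguments.
Unset Strict Implicit.
Unset Printing Implicit Defensive.

Import GRing.Theory.
Local Open Scope ring_scope.

(** Let H be the additive subgroup of R spanned by S and K the kernel of
    Phi : R -> F_2^r.  Connectedness of the Cayley graph of S means H = R, and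
    connectedness of the Cayley graph of Phi(S) means H + K = R.  That H = R
    forces both conditions is immediate, because every element of S lies in one
    of the ideals I_i and Phi is onto.

    For the converse, the point is that every element of K is an integral
    combination of units of R ([ker_F2_projection_sub]).  Indeed, units lift
    along R -> R / Rad R ([unit_mod_jacobson]), and in a matrix ring M_n(F)
    other than M_1(F_2) every scalar multiple of a matrix unit is a difference
    of two invertible matrices ([scale_delta_mx_unit_diff]); completing both
    with 1 in all the other factors of R / Rad R makes these cancel there, in
    particular in F_2^r.  The factor M_1(F_2) is excluded from R_0, since
    projecting onto it would give R_0 a quotient F_2.

    As S is stable under multiplication by units on either side, so is H, and
    hence K H and H K are contained in H ([ker_mul_gcd_span]).  As the ideals
    I_i add up to R, 1 is a sum of elements a s b with s in S, so that K K is
    contained in the span of K S K, hence in H ([ker_mul_ker_span]).  Since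
    R = H + K ([ker_complement_span]), one gets
                   K = K R = K H + K K  is contained in  H,
    and finally R = H + K = H. *)

(** * The span of a connection set *)

Section CayleySpan.
Variables (V : finZmodType) (S : {set V}).
Implicit Types (a b c s y : V).

(** The vertices that reach 0 are the sums of elements of S; in a finite group
    these sums already form the subgroup generated by S. *)
Definition cayley_span : {set V} := [set y | connect (cayley_graph S) y 0].

Lemma connect_cayleyD c a b :
  connect (cayley_graph S) a b -> connect (cayley_graph S) (a + c) (b + c).
Proof.
case/connectP=> p + ->; elim: p a => [|a' p IHp] a //= /andP[Saa' /IHp].
apply: connect_trans (connect1 _).
by rewrite /cayley_graph opprD addrACA subrr addr0.
Qed.

Lemma cayley_span0 : 0 \in cayley_span.
Proof. by rewrite inE. Qed.

Lemma mem_cayley_span s : s \in S -> s \in cayley_span.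
Proof. by move=> Ss; rewrite inE connect1 // /cayley_graph subr0. Qed.

Lemma cayley_spanD a b :
  a \in cayley_span -> b \in cayley_span -> a + b \in cayley_span.
Proof.
rewrite !inE => /(connect_cayleyD b); rewrite add0r; exact: connect_trans.
Qed.

Lemma cayley_span_sum (J : Type) (r : seq J) (f : J -> V) (P : pred J) :
  (forall j, P j -> f j \in cayley_span) ->
  \sum_(j <- r | P j) f j \in cayley_span.
Proof.
by move=> Hf; elim/big_rec: _ => [|j y /Hf];
  [exact: cayley_span0 | exact: cayley_spanD].
Qed.

Lemma cayley_span_ind (P : V -> Prop) :
  P 0 -> (forall s y, s \in S -> P y -> P (s + y)) ->
  forall y, y \in cayley_span -> P y.
Proof.
move=> P0 PS y; rewrite inE => /connectP[p].
elim: p y => [|y' p IHp] y /=; first by move=> _ <-.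
by case/andP=> Sy /IHp{}IHp /IHp Py'; rewrite -(subrK y' y); apply: PS.
Qed.

(** Translations are automorphisms of a Cayley graph, so a and b are joined as
    soon as a - b and 0 are. *)
Lemma cayley_connectedP :
  graph_connected (cayley_graph S) <-> forall y, y \in cayley_span.
Proof.
split=> [conS y | spanS a b]; first by rewrite inE.
have := spanS (a - b); rewrite inE => /(connect_cayleyD b).
by rewrite subrK add0r.
Qed.

End CayleySpan.

(** * Units modulo the Jacobson radical *)

Section Lifting.
Variable R : finUnitRingType.
Implicit Types x y j : R.

(** Left multiplication by x is injective, hence bijective as R is finite, so
    that x also has a right inverse. *)
Lemma left_inverse_unit x y : y * x = 1 -> x \is a GRing.unit.
Proof.
move=> yx1; have xI : injective ( *%R x).
  by move=> a b /(congr1 ( *%R y)); rewrite !mulrA yx1 !mul1r.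
have [g _ /(_ 1) xz1] := injF_bij xI.
apply/unitrP; exists y; split=> //; move: (g 1) xz1 => z xz1.
by suff -> : y = z by []; rewrite -[z]mul1r -yx1 -mulrA xz1 mulr1.
Qed.

(** If the left ideal R (1 + j) were proper, it would lie in a maximal left
    ideal; the latter contains j, hence would contain 1. *)
Lemma unit1D_jacobson j : j \in jacobson_radical R -> 1 + j \is a GRing.unit.
Proof.
move=> Jj; pose N := [set y | [exists b, y == b * (1 + j)]].
have NP y : reflect (exists b, y = b * (1 + j)) (y \in N).
  by rewrite inE; apply: (iffP existsP) => -[b];
    [move/eqP | move/eqP]; exists b.
have lN : left_ideal N.
  apply/left_idealP; split=> [|a b|a b].
  - by apply/NP; exists 0; rewrite mul0r.
  - by move=> /NP[c ->] /NP[d ->]; apply/NP; exists (c - d); rewrite mulrBl.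
  - by move=> /NP[c ->]; apply/NP; exists (a * c); rewrite mulrA.
have [/NP[b /esym]|N1] := boolP (1 \in N); first exact: left_inverse_unit.
have [|M mM sNM] := @maxset_exists _ (fun N => left_ideal N && (N != setT)) N.
  by rewrite lN left_ideal_proper.
have {}mM : maximal_left_ideal M by [].
have /maximal_left_idealP[lM /negP[]] := mM; have [_ MB _] := left_idealP _ lM.
rewrite -[1](addrK j) MB //; last by move/bigcapP: Jj; apply.
by apply/(subsetP sNM)/NP; exists 1; rewrite mul1r.
Qed.

Lemma unit_mod_jacobson x y :
  ss_proj y * ss_proj x = 1 -> x \is a GRing.unit.
Proof.
rewrite -rmorphM => yx1.
have Jyx : y * x - 1 \in jacobson_radical R.
  by rewrite -ss_projE; apply/eqP.
have := unit1D_jacobson Jyx; rewrite addrC subrK => Uyx.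
by apply: (@left_inverse_unit x ((y * x)^-1 * y)); rewrite -mulrA mulVr.
Qed.

End Lifting.

(** * Matrix units as differences of invertible matrices *)

(** Off the diagonal, a E_pq = (1 + a E_pq) - 1 is a transvection minus the
    identity.  Multiplying this by the transposition matrix that exchanges p and
    q gives a E_pp.  When n = 1 there is no q distinct from p, and one writes
    a = b c - b with b = a / (c - 1), where c is a scalar other than 0 and 1. *)
Lemma scale_delta_mx_unit_diff (F : fieldType) n (a : F) (p q : 'I_n) :
    n != 1%N \/ (exists2 c : F, c != 0 & c != 1) ->
  exists u v : 'M[F]_n,
    [/\ u \in unitmx, v \in unitmx & a *: delta_mx p q = u - v].
Proof.
have trans_unit i j : i != j -> 1%:M + a *: delta_mx i j \in @unitmx F n.
  move=> neq_ij; set E := a *: _.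
  have E2 : E *m E = 0.
    by rewrite -scalemxAl -scalemxAr mul_delta_mx_0 ?scaler0 // eq_sym.
  have /mulmx1_unit[]// : (1%:M + E) *m (1%:M - E) = 1%:M.
  by rewrite mulmxDl mul1mx mulmxBr mulmx1 E2 subr0 subrK.
move=> nF; have [eq_pq|neq_pq] := eqVneq p q; last first.
  exists (1%:M + a *: delta_mx p q), 1%:M.
  by rewrite trans_unit ?unitmx1 // addrC addKr.
subst q; have [q neq_pq|all_p] := pickP [pred q | p != q].
  exists ((1%:M + a *: delta_mx p q) *m tperm_mx p q), (tperm_mx p q).
  rewrite unitmx_mul trans_unit // unitmx_perm; split=> //.
  rewrite mulmxDl mul1mx addrC addKr -scalemxAl; congr (_ *: _).
  rewrite -xcolE; apply/matrixP=> i j; rewrite !mxE; congr ((_ && _)%:R).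
  by rewrite -(inj_eq (@perm_inj _ (tperm p q))) /= tpermL.
have eq_p i : i = p by have /negbFE/eqP := all_p i.
have n1 : n = 1%N.
  rewrite -(card_ord n); apply: (@eq_card1 _ p) => i.
  by rewrite !inE (eq_p i) eqxx.
case: nF => [/eqP//|[c nz_c neq_c1]].
have [->|nz_a] := eqVneq a 0.
  by exists 1%:M, 1%:M; rewrite unitmx1 subrr scale0r.
have nz_c1 : c - 1 != 0 by rewrite subr_eq0.
have unit_scalar b : b != 0 -> b%:M \in @unitmx F n.
  by move=> nz_b; rewrite unitmxE det_scalar unitfE expf_neq0.
exists (a / (c - 1) * c)%:M, (a / (c - 1))%:M.
rewrite !unit_scalar ?mulf_neq0 ?invr_neq0 //; split=> //.
apply/matrixP=> i j; rewrite !mxE (eq_p i) (eq_p j) !eqxx /= mulr1.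
by rewrite -[X in _ - X]mulr1 -mulrBr divfK.
Qed.

(** * Spans that are stable under units *)

Section GcdSpan.
Variables (R : finUnitRingType) (S : {set R}).
Hypothesis S_gcd : is_gcd_graph S.

Lemma gcd_set_unitM u s v :
  u \is a GRing.unit -> v \is a GRing.unit -> s \in S -> u * s * v \in S.
Proof.
move=> Uu Uv Ss; rewrite -S_gcd -mulrA; apply/imset2P.
by exists u (s * v); rewrite ?inE //; apply: imset2_f; rewrite ?inE.
Qed.

Lemma gcd_span_unitM u h v : u \is a GRing.unit -> v \is a GRing.unit ->
  h \in cayley_span S -> u * h * v \in cayley_span S.
Proof.
move=> Uu Uv; elim/cayley_span_ind: h / => [|s y Ss IHy].
  by rewrite mulr0 mul0r cayley_span0.
by rewrite mulrDr mulrDl cayley_spanD // mem_cayley_span ?gcd_set_unitM.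
Qed.

(** The span is closed under negation because -1 is a unit. *)
Lemma gcd_spanB g h :
  g \in cayley_span S -> h \in cayley_span S -> g - h \in cayley_span S.
Proof.
move=> Sg Sh; rewrite cayley_spanD //.
have := gcd_span_unitM (unitrN1 R) (unitr1 R) Sh.
by rewrite mulr1 mulN1r.
Qed.

End GcdSpan.

(** * A factor M_1(F_2) yields a quotient F_2 *)

Section FactorF2.
Variables (k : nat) (F : 'I_k -> finFieldType) (n : 'I_k -> nat) (i : 'I_k).
Hypotheses (n1 : n i = 1%N) (F01 : forall c : F i, c = 0 \/ c = 1).

Let p : 'I_(n i) := cast_ord (esym n1) ord0.

(** The isomorphism from a field with two elements to F_2 sends c to the truth
    value of c != 0. *)
Definition factor_to_F2 (w : matrix_product F n) : 'F_2 :=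
  ((w : ring_product _) i p p != 0)%:R.

Fact factor_to_F2_zmod : zmod_morphism factor_to_F2.
Proof.
move=> w w'; rewrite /factor_to_F2 !ffunE !mxE.
case: (F01 ((w : ring_product _) i p p)) => ->;
  case: (F01 ((w' : ring_product _) i p p)) => ->;
  rewrite ?subrr ?sub0r ?subr0 ?oppr_eq0 ?eqxx ?oner_eq0 //;
  exact: val_inj.
Qed.

Fact factor_to_F2_monoid : monoid_morphism factor_to_F2.
Proof.
have all_p q : q = p.
  by apply: val_inj; case: q => q /=; rewrite {1}n1; case: q.
split=> [|w w']; rewrite /factor_to_F2 !ffunE !mxE.
  by rewrite eqxx oner_neq0.
rewrite (bigD1 p) //= big1 ?addr0 => [|q /negP[]]; last by rewrite (all_p q).
by rewrite mulf_eq0 negb_or -natrM mulnb.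
Qed.

HB.instance Definition _ :=
  GRing.isZmodMorphism.Build (matrix_product F n) 'F_2
    factor_to_F2 factor_to_F2_zmod.
HB.instance Definition _ :=
  GRing.isMonoidMorphism.Build (matrix_product F n) 'F_2
    factor_to_F2 factor_to_F2_monoid.

Lemma factor_has_F2_quotient : has_F2_quotient (matrix_product F n).
Proof.
exists factor_to_F2 => -[[|[|//]] lt_y2].
  by exists 0; rewrite rmorph0; apply: val_inj.
by exists 1; rewrite rmorph1; apply: val_inj.
Qed.

End FactorF2.

(** * The kernel of Phi is spanned by units *)

Section KernelOfPhi.
Variables (R : finUnitRingType).
Variables (r k : nat) (F : 'I_k -> finFieldType) (n : 'I_k -> nat).
Hypothesis n_gt0 : forall i, (0 < n i)%N.
Hypothesis R0_noF2 : ~ has_F2_quotient (matrix_product F n).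
Variable phi : {rmorphism semisimple_quotient R ->
                          (F2_power r * matrix_product F n)%type}.
Hypothesis phi_iso : bijective phi.

Lemma phi_surj z : exists x, phi (ss_proj x) = z.
Proof.
have [psi _ psiK] := phi_iso; have [x projx] := ss_proj_surj (psi z).
by exists x; rewrite projx psiK.
Qed.

Lemma unit_of_phi x z : z * phi (ss_proj x) = 1 -> x \is a GRing.unit.
Proof.
have [y <-] := phi_surj z; rewrite -rmorphM -(rmorph1 phi).
by move/(bij_inj phi_iso)/unit_mod_jacobson.
Qed.

Lemma factor_not_F2 i : n i != 1%N \/ exists2 c : F i, c != 0 & c != 1.
Proof.
have [n1|] := eqVneq (n i) 1%N; last by left.
have [c /andP[c0 c1]|F01] := pickP [pred c : F i | (c != 0) && (c != 1)].
  by right; exists c.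
case: R0_noF2; apply: (factor_has_F2_quotient n1) => c.
by have /= := F01 c; case: eqVneq => [|_ /negbFE/eqP]; [left | right].
Qed.

Definition factor_with (w : matrix_product F n) i (M : 'M[F i]_(n i)) :
    matrix_product F n :=
  [ffun j => dfwith (fun j => (w : ring_product _) j) M j].

Lemma factor_with1M i (M N : 'M[F i]_(n i)) :
  M *m N = 1%:M -> factor_with 1 M * factor_with 1 N = 1.
Proof.
move=> MN1; apply/ffunP=> j; rewrite !ffunE.
have [<-|neq_ij] := eqVneq i j; first by rewrite !dfwith_in.
by rewrite !dfwith_out // ffunE mulr1.
Qed.

Lemma factor_with1B i (M N : 'M[F i]_(n i)) :
  factor_with 1 M - factor_with 1 N = factor_with 0 (M - N).
Proof.
apply/ffunP=> j; rewrite !ffunE.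
have [<-|neq_ij] := eqVneq i j; first by rewrite !dfwith_in.
by rewrite !dfwith_out // !ffunE subrr.
Qed.

Lemma factor_with0D i (M N : 'M[F i]_(n i)) :
  factor_with 0 (M + N) = factor_with 0 M + factor_with 0 N.
Proof.
apply/ffunP=> j; rewrite !ffunE.
have [<-|neq_ij] := eqVneq i j; first by rewrite !dfwith_in.
by rewrite !dfwith_out // !ffunE addr0.
Qed.

Lemma sum_factor_with (w : matrix_product F n) :
  w = \sum_i factor_with 0 ((w : ring_product _) i).
Proof.
apply/ffunP=> j.
rewrite (big_morph (fun v : matrix_product F n => (v : ring_product _) j)
           (id1 := 0) (op1 := +%R)); last 2 first.
- by move=> u v; rewrite ffunE.
- by rewrite ffunE.
rewrite (bigD1 j) //= big1 ?addr0 => [|i neq_ij]; rewrite ffunE ?dfwith_in //.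
by rewrite dfwith_out // ffunE.
Qed.

(** The span of the units of R is reached through an arbitrary additive subgroup
    U that contains them: this is the form in which it applies to the subgroup
    of the elements that multiply a given element into the span of S. *)
Section Subgroup.
Variable U : {set R}.
Hypothesis unitU : forall u, u \is a GRing.unit -> u \in U.
Hypothesis subU : forall x y, x \in U -> y \in U -> x - y \in U.

Definition lifts_into_U z := exists2 x, x \in U & phi (ss_proj x) = z.

Lemma lifts_into_UB z t :
  lifts_into_U z -> lifts_into_U t -> lifts_into_U (z - t).
Proof.
by case=> x Ux <- [y Uy <-]; exists (x - y); rewrite ?subU // !rmorphB.
Qed.

Lemma lifts_into_U0 : lifts_into_U 0.
Proof. by exists (1 - 1); rewrite ?subU ?unitU ?unitr1 // subrr !rmorph0. Qed.

Lemma lifts_into_UD z t :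
  lifts_into_U z -> lifts_into_U t -> lifts_into_U (z + t).
Proof.
move=> Vz Vt; rewrite -[t]opprK -[- t]add0r.
exact/lifts_into_UB/lifts_into_UB/Vt/lifts_into_U0.
Qed.

Lemma lifts_into_U_left_invertible z t : z * t = 1 -> lifts_into_U t.
Proof.
by have [x <-] := phi_surj t; move/unit_of_phi/unitU=> Ux; exists x.
Qed.

(** Both invertible matrices are completed by 1 in F_2^r and in the other
    factors, where their difference vanishes. *)
Lemma lifts_into_U_delta i (a : F i) p q :
  lifts_into_U (0, factor_with 0 (a *: delta_mx p q)).
Proof.
have [u [v [Uu Uv ->]]] := scale_delta_mx_unit_diff a p q (factor_not_F2 i).
have VU (M : 'M_(n i)) : M \in unitmx -> lifts_into_U (1, factor_with 1 M).
  move=> /mulVmx/factor_with1M M1.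
  apply: (@lifts_into_U_left_invertible (1, factor_with 1 (invmx M))).
  by congr (_, _); rewrite /= ?mulr1.
have -> : (0, factor_with 0 (u - v)) =
    (1, factor_with 1 u) - (1, factor_with 1 v)
      :> F2_power r * matrix_product F n.
  by rewrite -factor_with1B; congr (_, _); rewrite subrr.
exact/lifts_into_UB/VU/Uv/VU.
Qed.

Lemma lifts_into_U_0D w w' :
  lifts_into_U (0, w) -> lifts_into_U (0, w') -> lifts_into_U (0, w + w').
Proof.
move=> Vw Vw'.
have -> : (0, w + w') = (0, w) + (0, w') :> F2_power r * matrix_product F n.
  by congr (_, _); rewrite addr0.
exact: lifts_into_UD.
Qed.

Lemma lifts_into_U_factor_with i (M : 'M[F i]_(n i)) :
  lifts_into_U (0, factor_with 0 M).
Proof.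
have V0 : lifts_into_U (0, @factor_with 0 i 0).
  have p := Ordinal (n_gt0 i).
  rewrite -[X in factor_with _ X](scale0r (delta_mx p p)).
  exact: lifts_into_U_delta.
rewrite [M]matrix_sum_delta; elim/big_rec: _ => // p N _ VN.
rewrite factor_with0D; apply: lifts_into_U_0D => //.
elim/big_rec: _ => // q L _ VL; rewrite factor_with0D.
by apply: lifts_into_U_0D => //; apply: lifts_into_U_delta.
Qed.

Lemma lifts_into_U_factor w : lifts_into_U (0, w).
Proof.
rewrite [w]sum_factor_with; elim/big_rec: _ => [|i w' _ Vw'].
  exact: lifts_into_U0.
by apply: lifts_into_U_0D => //; apply: lifts_into_U_factor_with.
Qed.

(** If Phi x = 0, then x agrees modulo the radical with some y in U, and U
    contains every radical element j = (1 + j) - 1. *)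
Lemma ker_F2_projection_sub x : F2_projection phi x = 0 -> x \in U.
Proof.
rewrite /F2_projection; case Dz: (phi _) => [z w] /= z0.
have [y Uy] := lifts_into_U_factor w; rewrite -z0 -Dz => /(bij_inj phi_iso)/eqP.
rewrite ss_projE => /unit1D_jacobson/unitU Uj.
have -> : x = y - ((1 + (y - x)) - 1) by rewrite [1 + _]addrC addrK subKr.
by rewrite !subU // unitU ?unitr1.
Qed.

End Subgroup.

(** * Multiplying the span by the kernel of Phi *)

Variable S : {set R}.
Hypothesis S_gcd : is_gcd_graph S.

Notation Phi := (F2_projection phi).

Lemma F2_projectionD : {morph Phi : y z / y + z}.
Proof. by move=> y z; rewrite /F2_projection !rmorphD. Qed.

Lemma F2_projectionB : {morph Phi : y z / y - z}.
Proof. by move=> y z; rewrite /F2_projection !rmorphB. Qed.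

Lemma F2_projectionM : {morph Phi : y z / y * z}.
Proof. by move=> y z; rewrite /F2_projection !rmorphM. Qed.

Lemma F2_projection0 : Phi 0 = 0.
Proof. by rewrite /F2_projection !rmorph0. Qed.

Lemma F2_projection_surj z : exists y, Phi y = z.
Proof.
have [y Dy] := phi_surj (z, 0).
by exists y; rewrite /F2_projection Dy.
Qed.

(** The elements that multiply h into the span on both sides form an additive
    subgroup containing the units, hence K. *)
Lemma ker_mul_gcd_span x h : Phi x = 0 -> h \in cayley_span S ->
  x * h \in cayley_span S /\ h * x \in cayley_span S.
Proof.
move=> Kx Hh.
pose T := [set y | (y * h \in cayley_span S) && (h * y \in cayley_span S)].
have inT y :
    (y \in T) = (y * h \in cayley_span S) && (h * y \in cayley_span S).
  by rewrite in_set.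
apply/andP; rewrite -inT.
apply: (ker_F2_projection_sub _ _ Kx) => [u Uu|y z].
  rewrite inT -[u * h]mulr1 -[h * u]mul1r mulrA.
  by rewrite !gcd_span_unitM ?unitr1.
rewrite !inT mulrBl mulrBr => /andP[Hyh Hhy] /andP[Hzh Hhz].
by rewrite !gcd_spanB.
Qed.

(** Expanding 1 = sum of a_i x_i b_i in y * 1 * z gives terms
    (y a_i) x_i (b_i z), whose outer factors are still in K. *)
Lemma ker_mul_ker_span (J : finType) (I : {set J}) (x : J -> R) y z :
    (forall i, i \in I -> x i \in S) ->
    sum_ideals I (fun i => ideal_gen (x i)) 1 ->
  Phi y = 0 -> Phi z = 0 -> y * z \in cayley_span S.
Proof.
move=> Sx [w Iw D1] Ky Kz.
rewrite -[z]mul1r D1 mulr_suml mulr_sumr; apply: cayley_span_sum => i Ii.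
have [a ->] := Iw i Ii; rewrite mulr_suml mulr_sumr.
apply: cayley_span_sum => p _.
have -> : y * (p.1 * x i * p.2 * z) = y * p.1 * x i * (p.2 * z).
  by rewrite !mulrA.
have Hx : x i \in cayley_span S by rewrite mem_cayley_span ?Sx.
have Kyp : Phi (y * p.1) = 0 by rewrite F2_projectionM Ky mul0r.
have Kpz : Phi (p.2 * z) = 0 by rewrite F2_projectionM Kz mulr0.
by have [/(ker_mul_gcd_span Kpz)[]] := ker_mul_gcd_span Kyp Hx.
Qed.

(** Writing Phi y as a sum of elements of Phi(S) and lifting it term by term gives
    the component h of y in H. *)
Lemma ker_complement_span y :
  graph_connected (cayley_graph [set Phi s | s in S]) ->
  exists2 h, h \in cayley_span S & Phi (y - h) = 0.
Proof.
move/cayley_connectedP=> spanPhi.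
suff [h Hh Dh] : exists2 h, h \in cayley_span S & Phi h = Phi y.
  by exists h; rewrite // F2_projectionB Dh subrr.
elim/cayley_span_ind: (Phi y) / (spanPhi (Phi y)) => [|_ z /imsetP[s Ss ->]].
  by exists 0; rewrite ?cayley_span0 ?F2_projection0.
case=> h Hh <-; exists (s + h); last by rewrite F2_projectionD.
by rewrite cayley_spanD // mem_cayley_span.
Qed.

Lemma image_connected : graph_connected (cayley_graph S) ->
  graph_connected (cayley_graph [set Phi s | s in S]).
Proof.
move/cayley_connectedP=> spanS; apply/cayley_connectedP=> z.
have [y <-] := F2_projection_surj z.
elim/cayley_span_ind: y / (spanS y) => [|s y Ss IHy].
  by rewrite F2_projection0 cayley_span0.
by rewrite F2_projectionD cayley_spanD // mem_cayley_span // imset_f.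
Qed.

End KernelOfPhi.

(** * The connectedness criterion *)

Theorem theorem2p13 (R : finUnitRingType)
    (r k : nat) (F : 'I_k -> finFieldType) (n : 'I_k -> nat)
    (n_gt0 : forall i, (0 < n i)%N)
    (R0_noF2 : ~ has_F2_quotient (matrix_product F n))
    (phi : {rmorphism semisimple_quotient R ->
                      (F2_power r * matrix_product F n)%type})
    (phi_iso : bijective phi)
    (m : nat) (orb : 'I_m -> {set R})
    (orb_inj : injective orb)
    (orb_all : [set orb i | i : 'I_m] = unit_double_cosets R)
    (I : {set 'I_m}) (S : {set R})
    (S_union : S = \bigcup_(i in I) orb i)
    (S_gcd : is_gcd_graph S)
    (x : 'I_m -> R) (x_orb : forall i, i \in I -> x i \in orb i) :
  graph_connected (cayley_graph S) <->
    (forall y : R, sum_ideals I (fun i => ideal_gen (x i)) y)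
    /\ graph_connected (cayley_graph [set F2_projection phi s | s in S]).
Proof.
split=> [conS | [sumI conPhi]].
- split=> [y | ]; last exact: image_connected conS.
  move/cayley_connectedP: conS => spanS.
  elim/cayley_span_ind: y / (spanS y) => [|s y Ss [z Iz ->]].
    exists (fun=> 0); last by rewrite big1.
    by move=> i _; exists [::]; rewrite big_nil.
  move: Ss; rewrite S_union => /bigcupP[i Ii orb_s].
  have /imsetP[x0 _ Dorb] : orb i \in unit_double_cosets R.
    by rewrite -orb_all imset_f.
  have Is : ideal_gen (x i) s.
    have := x_orb i Ii; move: orb_s; rewrite Dorb => orb_s orb_xi.
    apply/(ideal_gen_unit_double_coset _ orb_xi).
    apply/(ideal_gen_unit_double_coset _ orb_s).
    by exists [:: (1, 1)]; rewrite big_seq1 mul1r mulr1.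
  exists (fun j => if j == i then s + z j else z j) => [j Ij|].
    case: eqVneq => [eq_ji | _]; last exact: Iz.
    have [a Da] := Is; have [b Db] := Iz j Ij.
    by subst j; exists (a ++ b); rewrite Da Db big_cat.
  rewrite !(bigD1 i Ii) /= eqxx addrA; congr (_ + _).
  by apply: eq_bigr => j /andP[_ /negPf->].
have Sx i : i \in I -> x i \in S.
  by move=> Ii; rewrite S_union; apply/bigcupP; exists i; rewrite ?x_orb.
have subK y : F2_projection phi y = 0 -> y \in cayley_span S.
  move=> Ky; have [h Hh K1h] := ker_complement_span 1 conPhi.
  (* K = K (K + H) = K K + K H, from the splitting of 1 *)
  rewrite -[y]mulr1 -(subrK h 1) mulrDr cayley_spanD //.
    exact: (ker_mul_ker_span _ _ phi_iso S_gcd Sx (sumI 1)).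
  by have [] := ker_mul_gcd_span n_gt0 R0_noF2 phi_iso S_gcd Ky Hh.
apply/cayley_connectedP=> y; have [h Hh Kyh] := ker_complement_span y conPhi.
by rewrite -(subrK h y) cayley_spanD // subK.
Qed.
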